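(* Let $Z=\{z_1,\dots,z_n\}\subset\mathbb{D}\setminus\{0\}$ be a finite set of $n$ distinct points, let $g_Z$ be the Shapiro-Shields function associated with $Z$, and let $\mathrm{dist}_H(1,[g_Z])$ denote the distance in $H$ from the constant function $1$ to $[g_Z]$. Then, letting $v=(1,\dots,1)$ be the row vector with $n$ entries equal to $1$, and $v^*$ its conjugate transpose, $$\mathrm{dist}_H^2(1,[g_Z])=vK_Z^{-1}v^*.$$
   Context: Let $\omega=(\omega_k)_{k\ge 0}$ be a sequence of positive real numbers with $\omega_0=1$ and $\lim_{k\to\infty}\omega_k/\omega_{k+1}=1$. Let $\mathbb{D}$ be the open unit disk in $\mathbb{C}$. $H=H^2_\omega$ is the Hilbert space of holomorphic functions $f(z)=\sum_{k\ge0}a_kz^k$ on $\mathbb{D}$ with $\|f\|_\omega^2:=\sum_{k\ge0}|a_k|^2\omega_k<\infty$, with inner product $\langle\sum a_kz^k,\sum b_kz^k\rangle=\sum_k a_k\overline{b_k}\,\omega_k$. Multiplication by $z$ is a bounded operator on $H$. For $w\in\mathbb{D}$, $k_w(z)=\sum_{k\ge0}\overline{w}^kz^k/\omega_k$ is the reproducing kernel of $H$ at $w$, so $g(w)=\langle g,k_w\rangle$ for $g\in H$. For $f\in H$, $[f]$ denotes the closure in $H$ of $\{pf: p\text{ a polynomial}\}$. For $Z=\{z_1,\dots,z_n\}$, $K_Z$ is the $n\times n$ matrix with entries $K_{i,j}=\langle k_{z_i},k_{z_j}\rangle$, $i,j=1,\dots,n$ (it is invertible when the points $z_i$ are distinct).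 The function $f_Z$ is the $(n+1)\times(n+1)$ determinant $$f_Z(z)=\begin{vmatrix}1&1&\cdots&1\\ k_{z_1}(z)&K_{1,1}&\cdots&K_{1,n}\\ \vdots&\vdots&&\vdots\\ k_{z_n}(z)&K_{n,1}&\cdots&K_{n,n}\end{vmatrix},$$ and the Shapiro-Shields function for $Z$ is $g_Z:=f_Z/\|f_Z\|_\omega$. *)

(* Defs.v *)
From mathcomp Require Import all_boot all_order all_algebra.
From mathcomp Require Import all_classical all_reals all_analysis.
From mathcomp Require Import complex.

Set Implicit Arguments.
Unset Strict Implicit.
Unset Printing Implicit Defensive.

Import Order.TTheory GRing.Theory Num.Theory.
Import numFieldNormedType.Exports.
Import ComplexField.Normc.

Local Open Scope classical_set_scope.
Local Open Scope ring_scope.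
Local Open Scope complex_scope.

(* R[i] as a bundled numClosedFieldType: the norm topology is then the one
   MathComp-Analysis puts on any numFieldType. *)
Definition Cplx (R : realType) : numClosedFieldType := R[i].

Section WeightedHardy.
Variables (R : realType) (w : nat -> R).
Local Notation C := (Cplx R).

(* Functions on the open unit disk are represented by total functions C -> C;
   the definitions of H2, coefs, H2norm and inner only depend on the values
   on the disk. *)
Definition power_series (a : nat -> C) (f : C -> C) : Prop :=
  forall z : C, `|z| < 1 -> series (fun k => a k * z ^+ k) @ \oo --> f z.

Definition H2 : set (C -> C) :=
  [set f | exists2 a : nat -> C, power_series a f &
           cvgn (series (fun k => normc (a k) ^+ 2 * w k))].

(* The coefficient sequence of a power series converging on the disk is
   unique, so the choice made by xget is no choice when f is analytic;
   on other functions it returns the zero sequence. *)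
Definition coefs (f : C -> C) : nat -> C :=
  xget (fun=> 0) [set a | power_series a f].

Definition H2norm (f : C -> C) : R :=
  Num.sqrt (limn (series (fun k => normc (coefs f k) ^+ 2 * w k))).

Definition inner (f g : C -> C) : C :=
  limn (series (fun k => coefs f k * (coefs g k)^* * (w k)%:C : C)).

Definition repr_kernel (x : C) : C -> C :=
  fun z => limn (series (fun k => x^* ^+ k * z ^+ k / (w k)%:C : C)).

(* [f], the closure in H2 of the polynomial multiples of f, for f in H2.
   When w k / w k.+1 tends to 1, H2 is stable under multiplication by z,
   so H2norm is only applied to elements of H2. *)
Definition cyclic_subspace (f : C -> C) : set (C -> C) :=
  [set h | H2 h /\ forall e : R, 0 < e ->
           exists p : {poly C}, H2norm (fun z => h z - p.[z] * f z) < e].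

Definition distH (f : C -> C) (S : set (C -> C)) : R :=
  inf [set H2norm (fun z => f z - g z) | g in S].

Section Points.
Variables (n : nat) (Z : 'I_n -> C).

Definition gram : 'M[C]_n :=
  \matrix_(i, j) inner (repr_kernel (Z i)) (repr_kernel (Z j)).

Definition f_Z : C -> C := fun z =>
  \det (block_mx (1%:M : 'M[C]_1)        (const_mx 1 : 'rV[C]_n)
                 (\col_i repr_kernel (Z i) z) gram).

Definition shapiro_shields : C -> C := fun z => f_Z z / (H2norm f_Z)%:C.

End Points.
End WeightedHardy.

(* Main.v *)
Require Import Defs.
From mathcomp Require Import all_boot all_order all_algebra.
From mathcomp Require Import all_classical all_reals all_analysis.
From mathcomp Require Import complex.
From mathcomp Require Import ring lra.

Set Implicit Arguments.
Unset Strict Implicit.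
Unset Printing Implicit Defensive.

Import Order.TTheory GRing.Theory Num.Theory.
Import numFieldNormedType.Exports.

Local Open Scope classical_set_scope.
Local Open Scope ring_scope.
Local Open Scope complex_scope.
Local Open Scope sesquilinear_scope.

(** Let k_x denote the reproducing kernel at x and K the Gram matrix of the
    kernels at the points of Z.  Put c = v K^-1 and u = sum_i c_i k_(z_i).
    Since k_(z_i)(z_j) = K_ij, the values of u at the points of Z are the
    entries of v K^-1 K = v: u takes the value 1 on Z ([kernel_comb_interpolates]).
    Expanding the bordered determinant by a Schur complement gives
    f_Z = det K (1 - u) ([f_ZE]), so 1 - u is a scalar multiple of g_Z and lies
    in [g_Z], while every element of [g_Z] vanishes on Z because g_Z does and
    because point evaluations are bounded ([cyclic_subspace_vanish]).

    For every f of the space, expanding ||f - u||^2 >= 0 and using the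
    reproducing property to compute <f, u> gives
      ||f||^2 >= 2 Re (sum_j conj(c_j) f(z_j)) - ||u||^2
    ([H2norm_ge_kernel_comb]).  When f = 1 - h with h in [g_Z], all the values
    f(z_j) are 1 = u(z_j), so the sum is ||u||^2 and ||1 - h|| >= ||u||, with
    equality for h = 1 - u.  Hence the distance is ||u||, and
    ||u||^2 = sum_j conj(c_j) u(z_j) = sum_j conj(c_j), a real number, which
    is therefore also sum_j c_j = v K^-1 v^*.

    The same inequality, for a single point x and a multiple of k_x, gives the
    boundedness of the evaluation at x ([H2_eval_bounded]).  The matrix K is
    invertible ([gram_unitmx]): if x K = 0, then the combination of kernels
    with coefficients x vanishes on Z, so it has norm 0 and all its Taylor
    coefficients vanish, and interpolation polynomials give x = 0.

    The hypothesis on the weights enters twice: w_(k+1) / w_k is bounded, so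
    polynomials multiply the space into itself ([H2_horner]), and the kernel
    series converges on the disk by the ratio test ([kernel_power_series]).
    The norm of f is computed from the coefficients that [coefs] chooses, which
    makes the uniqueness of power series coefficients ([coefsE]) part of the
    argument. *)

(** * Limits in the complex numbers *)

Section ComplexLimits.
Variable R : realType.
Local Notation C := (Cplx R).
Local Notation normc := (@ComplexField.Normc.normc R).
Implicit Types (z : C) (a u : nat -> C).

Lemma normCE z : `|z| = (normc z)%:C.
Proof. by []. Qed.

Lemma Re_real (x : R) : complex.Re (x%:C : C) = x.
Proof. by []. Qed.

Lemma conjCE (x y : R) : ((x +i* y : C)^*)%R = x -i* y.
Proof. by []. Qed.

Lemma sqr_normcE z : normc z ^+ 2 = complex.Re z ^+ 2 + complex.Im z ^+ 2.
Proof. by case: z => x y; rewrite /= sqr_sqrtr// addr_ge0// sqr_ge0. Qed.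

Lemma normc_ge0 z : 0 <= normc z.
Proof. by case: z => x y; exact: sqrtr_ge0. Qed.

Lemma Re_le_normc z : `|complex.Re z| <= normc z.
Proof. by case: z => x y; rewrite /= -sqrtr_sqr ler_wsqrtr// lerDl sqr_ge0. Qed.

Lemma Im_le_normc z : `|complex.Im z| <= normc z.
Proof. by case: z => x y; rewrite /= -sqrtr_sqr ler_wsqrtr// lerDr sqr_ge0. Qed.

Lemma normc_le_ReIm z : normc z <= `|complex.Re z| + `|complex.Im z|.
Proof.
rewrite -ler_sqr ?nnegrE ?normc_ge0 ?addr_ge0// sqr_normcE sqrrD !real_normK ?num_real//.
by rewrite -addrA lerD2l lerDr mulrn_wge0// mulr_ge0.
Qed.

(** Complex limits are tested against complex radii; a positive complex number
    is a positive real one, so real radii are enough. *)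
Lemma cvgC_normcP u (l : C) :
  (u @ \oo --> l) <-> ((fun n => normc (l - u n)) @ \oo --> (0 : R)).
Proof.
split=> ul.
  apply/cvgr0Pnorm_lt => e e0.
  move/cvgrPdist_lt: ul => /(_ e%:C); rewrite ltcR => /(_ e0).
  apply: filterS => n; rewrite normCE ltcR.
  by rewrite ger0_norm// normc_ge0.
apply/cvgrPdist_lt => e.
case: e => e f; rewrite ltcE/= => /andP[/eqP-> e0].
move/cvgr0Pnorm_lt: ul => /(_ e e0).
by apply: filterS => n; rewrite normCE ltcR ger0_norm// normc_ge0.
Qed.

Lemma cvg_Re u (l : C) : u @ \oo --> l ->
  (fun n => complex.Re (u n)) @ \oo --> complex.Re l.
Proof.
move/cvgC_normcP/cvgr0Pnorm_lt => ul; apply/cvgrPdist_lt => e e0.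
apply: filterS (ul _ e0) => n; apply: le_lt_trans.
rewrite -raddfB; apply: le_trans (ler_norm _); exact: Re_le_normc.
Qed.

Lemma cvg_ReIm u (l : C) :
  (fun n => complex.Re (u n)) @ \oo --> complex.Re l ->
  (fun n => complex.Im (u n)) @ \oo --> complex.Im l -> u @ \oo --> l.
Proof.
move=> /cvgrPdist_lt ur /cvgrPdist_lt ui; apply/cvgC_normcP/cvgr0Pnorm_lt => e e0.
have e2 : 0 < e / 2 by rewrite divr_gt0.
near=> n; rewrite ger0_norm ?normc_ge0//.
apply: le_lt_trans (normc_le_ReIm _) _; rewrite !raddfB/= (splitr e) ltrD//.
  by near: n; exact: ur.
by near: n; exact: ui.
Unshelve. all: by end_near. Qed.

Lemma series_Re a n :
  complex.Re (series a n) = series (fun k => complex.Re (a k)) n.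
Proof. by rewrite !seriesEnat/= raddf_sum. Qed.

Lemma series_Im a n :
  complex.Im (series a n) = series (fun k => complex.Im (a k)) n.
Proof. by rewrite !seriesEnat/= raddf_sum. Qed.

(** Completeness of the real line, applied to the real and the imaginary parts,
    which are both dominated by the modulus. *)
Lemma cvg_series_normc a : cvgn (series (fun k => normc (a k))) ->
  cvgn (series a).
Proof.
move=> ca.
have cr : cvgn (series (fun k => complex.Re (a k))).
  apply: normed_cvg; apply: series_le_cvg ca => n.
  - exact: normr_ge0.
  - exact: normc_ge0.
  - exact: Re_le_normc.
have ci : cvgn (series (fun k => complex.Im (a k))).
  apply: normed_cvg; apply: series_le_cvg ca => n.
  - exact: normr_ge0.
  - exact: normc_ge0.
  - exact: Im_le_normc.
apply/cvg_ex; exists (limn (series (fun k => complex.Re (a k))) +i*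
   limn (series (fun k => complex.Im (a k)))).
apply: cvg_ReIm => /=.
  by under eq_fun do rewrite series_Re; exact: cr.
by under eq_fun do rewrite series_Im; exact: ci.
Qed.

End ComplexLimits.

(** * Power series on the unit disk *)

Section PowerSeries.
Variable R : realType.
Local Notation C := (Cplx R).
Local Notation normc := (@ComplexField.Normc.normc R).
Implicit Types (z : C) (a b : nat -> C) (f g : C -> C).

Lemma power_seriesD a b f g : power_series a f -> power_series b g ->
  power_series (fun k => a k + b k) (fun z => f z + g z).
Proof.
move=> af bg z z1.
under eq_fun do rewrite mulrDl.
rewrite [X in X @ \oo](_ : _ =
  series (fun k => a k * z ^+ k) \+ series (fun k => b k * z ^+ k)).
  exact: cvgD (af z z1) (bg z z1).
by apply/funext => N; rewrite !seriesEnat /= big_split.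
Qed.

Lemma power_seriesZ (c : C) a f : power_series a f ->
  power_series (fun k => c * a k) (fun z => c * f z).
Proof.
move=> af z z1.
rewrite [X in X @ \oo](_ : _ = fun N => c * series (fun k => a k * z ^+ k) N).
  by apply: cvgMl_tmp; exact: af.
apply/funext => N; rewrite !seriesEnat /= mulr_sumr.
by apply: eq_bigr => k _; rewrite mulrA.
Qed.

Lemma power_series0 : power_series (fun=> 0) (fun=> 0 : C).
Proof.
move=> z _; under eq_fun do rewrite mul0r.
rewrite [X in X @ \oo](_ : _ = fun=> 0); first exact: cvg_cst.
by apply/funext => N; rewrite seriesEnat /= big1.
Qed.

Lemma power_series_sum (I : Type) (r : seq I) (a_ : I -> nat -> C) (f_ : I -> C -> C) :
  (forall i, power_series (a_ i) (f_ i)) ->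
  power_series (fun k => \sum_(i <- r) a_ i k) (fun z => \sum_(i <- r) f_ i z).
Proof.
move=> af z z1.
rewrite [X in X @ \oo](_ : _ =
    fun N => \sum_(i <- r) series (fun k => a_ i k * z ^+ k) N).
  by apply: cvg_big => [|i _]; [exact: add_continuous|exact: af].
apply/funext => N; rewrite seriesEnat/=.
under eq_bigr do rewrite mulr_suml.
rewrite exchange_big/=; apply: eq_bigr => i _.
by rewrite seriesEnat.
Qed.

Definition shift_coefs a : nat -> C := fun k => if k is k'.+1 then a k' else 0.

Lemma power_seriesX a f : power_series a f ->
  power_series (shift_coefs a) (fun z => z * f z).
Proof.
move=> af z z1; rewrite -cvg_shiftS /=.
rewrite [X in X @ \oo](_ : _ = fun N => z * series (fun k => a k * z ^+ k) N).
  by apply: cvgMl_tmp; exact: af.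
apply/funext => N; rewrite !seriesEnat /= big_nat_recl//= mul0r add0r mulr_sumr.
by apply: eq_bigr => k _; rewrite exprS mulrCA.
Qed.

Lemma power_series_cst (c : C) :
  power_series (fun k => if k is 0%N then c else 0) (fun=> c).
Proof.
move=> z _; rewrite -cvg_shiftS /=.
rewrite [X in X @ \oo](_ : _ = fun=> c); first exact: (@cvg_cst C).
apply/funext => N; rewrite seriesEnat /= big_nat_recl//= expr0 mulr1.
by rewrite big1 ?addr0// => k _; rewrite mul0r.
Qed.

Lemma power_series_ext a f g : (forall z, `|z| < 1 -> f z = g z) ->
  power_series a f -> power_series a g.
Proof. by move=> fg af z z1; rewrite -fg//; exact: af. Qed.

Lemma normcX z k : normc (z ^+ k) = normc z ^+ k.
Proof.
elim: k => [|k IH]; first by rewrite !expr0 ComplexField.Normc.normc1.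
by rewrite !exprS ComplexField.Normc.normcM IH.
Qed.

Lemma normc_sum (F : nat -> C) N :
  normc (\sum_(0 <= k < N) F k) <= \sum_(0 <= k < N) normc (F k).
Proof.
rewrite -lecR -normCE rmorph_sum/=.
by under [X in _ <= X]eq_bigr do rewrite -normCE; exact: ler_norm_sum.
Qed.

Lemma normcNE z : normc (- z) = normc z.
Proof. by case: z => x y /=; rewrite !sqrrN. Qed.

Lemma geometric_le2 (x : R) N : 0 <= x -> x <= 2^-1 ->
  \sum_(0 <= k < N) x ^+ k <= 2.
Proof.
move=> x0 x2; have := subrX1 x N; have := exprn_ge0 N x0.
by rewrite -(big_mkord xpredT (fun i => x ^+ i)); nra.
Qed.

(** The sum is only known to vanish away from 0, so it cannot be evaluated
    at 0.  Convergence at 1/2 gives |a_k| <= M 2^k, hence for a real r < 1/4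
    the tail from index 1 is at most sum_(k >= 1) M (2 r)^k <= 4 M r, and
    |a_0| is bounded by this for every small r. *)
Lemma power_series_first_coef0 a :
  (forall z, z != 0 -> `|z| < 1 -> series (fun k => a k * z ^+ k) @ \oo --> (0 : C)) ->
  a 0%N = 0.
Proof.
move=> a0; apply: ComplexField.Normc.eq0_normc; apply/eqP; rewrite eq_le normc_ge0 andbT.
have rC (r : R) : 0 < r -> r < 1 ->
    [/\ (r%:C : C) != 0, `|(r%:C : C)| < 1 & normc r%:C = r].
  move=> r0 r1.
  have nr : normc r%:C = r by rewrite /= expr0n addr0 sqrtr_sqr gtr0_norm.
  by rewrite normCE nr ltcR; split => //; rewrite eq_complex /= gt_eqF.
have [M M0 aM] : exists2 M : R, 0 < M & forall k, normc (a k) <= M * 2 ^+ k.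
  have [h0 h1 nh] := rC 2^-1 ltac:(lra) ltac:(lra).
  have /cvg_series_cvg_0 : cvgn (series (fun k => a k * (2^-1)%:C ^+ k)).
    by apply/cvg_ex; exists 0; exact: a0.
  move=> /cvgC_normcP/cvgP/cvg_seq_bounded/pinfty_ex_gt0[M M0 HM].
  exists M => // k; have := HM k I.
  rewrite /= sub0r ger0_norm ?normc_ge0// normcNE ComplexField.Normc.normcM normcX nh.
  by rewrite exprVn ler_pdivrMr// exprn_gt0.
rewrite leNgt; apply/negP => A0; set A := normc _ in A0.
(* This r makes both 4 M r <= A / 4 and r < 1 / 4. *)
pose r := A / (16 * M + 5 * A).
have D0 : 0 < 16 * M + 5 * A by lra.
have r0 : 0 < r by rewrite divr_gt0.
have rD : r * (16 * M + 5 * A) = A by rewrite divfK// gt_eqF.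
have r4 : r < 4^-1 by nra.
have rM : 4 * M * r <= A / 4 by nra.
have [rz r1 nr] := rC r r0 ltac:(lra).
have /cvgC_normcP/cvgr0Pnorm_lt/(_ (A / 4)) := a0 _ rz r1.
move=> /(_ ltac:(lra)) [N _ /(_ N.+1 (leqnSn _))].
rewrite /= sub0r ger0_norm ?normc_ge0// normcNE seriesEnat/= big_nat_recl//= expr0 mulr1.
set T := \sum_(_ <= _ < _) _ => ST.
have TM : normc T <= 4 * M * r.
  apply: le_trans (normc_sum _ _) _.
  apply: (@le_trans _ _ (2 * M * r * \sum_(0 <= k < N) (2 * r) ^+ k)).
    rewrite mulr_sumr; apply: ler_sum_nat => k _.
    rewrite ComplexField.Normc.normcM normcX nr.
    have -> : 2 * M * r * (2 * r) ^+ k = M * 2 ^+ k.+1 * r ^+ k.+1.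
      by rewrite !exprS exprMn; ring.
    by rewrite ler_wpM2r// exprn_ge0// ltW.
  have := @geometric_le2 (2 * r) N ltac:(lra) ltac:(lra).
  have : 0 < M * r by rewrite mulr_gt0.
  nra.
have : A <= normc (a 0%N + T) + normc T.
  have : `|a 0%N| <= `|a 0%N + T| + `|T| by rewrite -[X in `|X| <= _](addrK T) ler_normB.
  by rewrite !normCE -rmorphD lecR.
lra.
Qed.

(** Once a_0 = 0, dividing by z gives a series with shifted coefficients that
    sums to 0 off the origin; its constant term then vanishes too, so it sums to
    0 on the whole disk and the induction goes through. *)
Lemma power_series_eq0 a : power_series a (fun=> 0) -> a =1 fun=> 0.
Proof.
move=> ps k; elim: k a ps => [|k IH] a ps.
  by apply: power_series_first_coef0 => z _; exact: ps.
have a0 : a 0%N = 0.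
  by apply: power_series_first_coef0 => z _; exact: ps.
have pz z : z != 0 -> `|z| < 1 -> series (fun k => a k.+1 * z ^+ k) @ \oo --> (0 : C).
  move=> z0 z1; have := ps z z1; rewrite -cvg_shiftS/= => H.
  rewrite [X in X @ \oo](_ : _ = fun N => z^-1 * series (fun k => a k * z ^+ k) N.+1).
    by rewrite -[X in _ --> X](mulr0 z^-1); exact: cvgMl_tmp.
  apply/funext => N; rewrite !seriesEnat/= big_nat_recl//= a0 mul0r add0r mulr_sumr.
  by apply: eq_bigr => i _; rewrite exprS mulrCA mulKf.
apply: (IH (fun k => a k.+1)) => z z1; have [->|z0] := eqVneq z 0; last exact: pz.
rewrite -cvg_shiftS/= [X in X @ \oo](_ : _ = fun=> 0); first exact: (@cvg_cst C).
apply/funext => N; rewrite seriesEnat/= big_nat_recl//= expr0 mulr1.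
rewrite (power_series_first_coef0 pz) add0r big1// => i _.
by rewrite expr0n mulr0.
Qed.

(** The choice made in [coefs] is harmless because power series coefficients
    are unique. *)
Lemma coefsE a f : power_series a f -> coefs f = a.
Proof.
move=> af; rewrite /coefs; apply/funext => k.
have bf := @xgetPex _ (fun=> 0) [set a | power_series a f] (ex_intro _ a af).
apply/eqP; rewrite -subr_eq0; apply/eqP; set b := xget _ _ in bf *.
apply: (@power_series_eq0 (fun k => b k - a k)).
apply: (@power_series_ext _ (fun z => f z + (-1) * f z)).
  by move=> z _; rewrite mulN1r subrr.
have := power_seriesD bf (power_seriesZ (c := -1) af).
rewrite [X in power_series X _](_ : _ = fun k => b k - a k)//.
by apply/funext => i; rewrite mulN1r.
Qed.

End PowerSeries.

(** * The weighted space and its kernels *)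

(** The sequence t is dominated by c rho^k, where c is chosen large enough for
    the finitely many indices at which the ratio is not yet controlled. *)
Lemma ratio_test (R : realType) (t : nat -> R) (rho : R) :
  (forall k, 0 <= t k) -> 0 < rho -> rho < 1 ->
  (\forall k \near \oo, t k.+1 <= rho * t k) -> cvgn (series t).
Proof.
move=> t0 r0 r1 [N _ HN].
pose c := \sum_(i < N.+1) t i / rho ^+ i.
have rk k : 0 < rho ^+ k by rewrite exprn_gt0.
have tc k : t k <= c * rho ^+ k.
  elim: k => [|k IH].
    rewrite expr0 mulr1 /c big_ord_recl/= expr0 invr1 mulr1 lerDl.
    by apply: sumr_ge0 => i _; rewrite divr_ge0// ltW.
  have [kN|Nk] := ltnP k N.
    rewrite -ler_pdivrMr// /c (bigD1 (inord k.+1 : 'I_N.+1))//= inordK ?ltnS// lerDl.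
    by apply: sumr_ge0 => i _; rewrite divr_ge0// ltW.
  apply: le_trans (HN k Nk) _.
  by rewrite exprS mulrCA ler_wpM2l// ltW.
have c0 : 0 <= c by apply: sumr_ge0 => i _; rewrite divr_ge0// ltW.
apply: (@series_le_cvg _ _ (geometric c rho)) => // [k|]; last first.
  by apply: is_cvg_geometric_series; rewrite gtr0_norm.
by rewrite /= mulr_ge0// ltW.
Qed.

Section WeightedSpace.
Variables (R : realType) (w : nat -> R).
Hypothesis w_gt0 : forall k, 0 < w k.
Hypothesis w_lim : (fun k => w k / w k.+1) @ \oo --> (1 : R).
Local Notation C := (Cplx R).
Local Notation normc := (@ComplexField.Normc.normc R).
Implicit Types (z x : C) (a b : nat -> C) (f g : C -> C).

Definition energy a : nat -> R := fun k => normc (a k) ^+ 2 * w k.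

Lemma energy_ge0 a k : 0 <= energy a k.
Proof. by rewrite mulr_ge0 ?sqr_ge0// ltW. Qed.

Lemma H2_coefs f : H2 w f -> power_series (coefs f) f /\ cvgn (series (energy (coefs f))).
Proof. by case=> a af ca; rewrite (coefsE af). Qed.

Lemma H2normE a f : power_series a f ->
  H2norm w f = Num.sqrt (limn (series (energy a))).
Proof. by move=> af; rewrite /H2norm (coefsE af). Qed.

(** The ratios w_(k+1) / w_k converge, to the inverse of 1, and are thus bounded. *)
Lemma weight_step_le : exists2 M : R, 0 < M & forall k, w k.+1 <= M * w k.
Proof.
have : (fun k => (w k / w k.+1)^-1) @ \oo --> (1^-1 : R).
  by apply: cvgV => //; exact: oner_neq0.
move=> /cvgP/cvg_seq_bounded/pinfty_ex_gt0[M M0 HM].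
exists M => // k; have := HM k I; rewrite /= invf_div.
rewrite ger0_norm; last by rewrite divr_ge0// ltW.
by rewrite ler_pdivrMr.
Qed.

(** |a + b|^2 <= 2 (|a|^2 + |b|^2). *)
Lemma H2D f g : H2 w f -> H2 w g -> H2 w (fun z => f z + g z).
Proof.
move=> [a af ca] [b bg cb]; exists (fun k => a k + b k); first exact: power_seriesD.
apply: (@series_le_cvg _ _ ((2 : R) *: (energy a + energy b))) => [k|k|k|].
- exact: (energy_ge0 (fun k => a k + b k)).
- by rewrite /= mulr_ge0// addr_ge0 ?energy_ge0.
- have -> : ((2 : R) *: (energy a + energy b)) k =
      2 * (normc (a k) ^+ 2 + normc (b k) ^+ 2) * w k.
    by transitivity (2 * (energy a k + energy b k)) => //; rewrite /energy; ring.
  rewrite ler_wpM2r ?(ltW (w_gt0 _))// !sqr_normcE.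
  case: (a k) (b k) => x y [x' y'] /=.
  have := sqr_ge0 (x - x'); have := sqr_ge0 (y - y'); nra.
- by apply: is_cvg_seriesZ; apply: is_cvg_seriesD.
Qed.

Lemma H2Z (c : C) f : H2 w f -> H2 w (fun z => c * f z).
Proof.
move=> [a af ca]; exists (fun k => c * a k); first exact: power_seriesZ.
rewrite (_ : (fun k => _) = (normc c ^+ 2) *: energy a); first exact: is_cvg_seriesZ.
apply/funext => k; rewrite ComplexField.Normc.normcM exprMn -mulrA.
by [].
Qed.

(** Multiplication by z shifts the coefficients, and the weights grow at most by
    a constant factor at each step. *)
Lemma H2X f : H2 w f -> H2 w (fun z => z * f z).
Proof.
move=> [a af ca]; exists (shift_coefs a); first exact: power_seriesX.
have [M M0 wM] := weight_step_le.
rewrite -(is_cvg_series_restrict 1).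
have c1 : cvgn (series (M *: energy a)) by exact: is_cvg_seriesZ.
have : cvgn (series (fun k => normc (a k) ^+ 2 * w k.+1)).
  apply: series_le_cvg c1 => k.
  - by rewrite mulr_ge0 ?sqr_ge0 ?ltW.
  - by apply: (@mulr_ge0 _ M (energy a k)); rewrite ?energy_ge0 ?ltW.
  have -> : (M *: energy a) k = normc (a k) ^+ 2 * (M * w k).
    by transitivity (M * energy a k) => //; rewrite /energy; ring.
  by rewrite ler_wpM2l ?sqr_ge0.
move=> /cvg_ex[l cl]; apply/cvg_ex; exists l; rewrite -cvg_shiftS /=.
apply: cvg_trans cl; apply: near_eq_cvg; near=> N.
by rewrite seriesEnat/= big_add1.
Unshelve. all: by end_near. Qed.

Lemma H2_cst (c : C) : H2 w (fun=> c).
Proof.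
exists (fun k => if k is 0%N then c else 0); first exact: power_series_cst.
apply/cvg_ex; exists (normc c ^+ 2 * w 0%N); rewrite -cvg_shiftS/=.
rewrite [X in X @ \oo](_ : _ = fun=> normc c ^+ 2 * w 0%N); first exact: cvg_cst.
apply/funext => N; rewrite seriesEnat/= big_nat_recl//= big1 ?addr0// => k _.
by rewrite expr0n addr0 sqrtr0 expr0n mul0r.
Qed.

Lemma H2_horner (p : {poly C}) f : H2 w f -> H2 w (fun z => p.[z] * f z).
Proof.
move=> Hf; elim/poly_ind: p => [|p c IH].
  rewrite (_ : (fun z => _) = fun=> 0); first exact: H2_cst.
  by apply/funext => z; rewrite horner0 mul0r.
rewrite (_ : (fun z => _) = fun z => z * (p.[z] * f z) + c * f z).
  exact: H2D (H2X IH) (H2Z _ Hf).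
by apply/funext => z; rewrite hornerMXaddC; ring.
Qed.

(** The terms are dominated by (|x||z|)^k / w_k, whose successive ratios tend
    to |x||z| < 1. *)
Lemma kernel_power_series x : `|x| < 1 ->
  power_series (fun k => (x^* ^+ k / (w k)%:C)%R) (repr_kernel w x).
Proof.
move=> x1 z z1.
pose t k := (normc x * normc z) ^+ k / w k.
have q0 : 0 <= normc x * normc z by rewrite mulr_ge0 ?normc_ge0.
have q1 : normc x * normc z < 1.
  have : `|x| * `|z| < 1 by rewrite mulr_ilt1.
  by rewrite !normCE -rmorphM ltcR.
suff : cvgn (series t).
  move=> ct; have E k : (x^* ^+ k / (w k)%:C * z ^+ k = x^* ^+ k * z ^+ k / (w k)%:C)%R.
    by rewrite mulrAC.
  under eq_fun do rewrite E.
  apply: cvg_series_normc; rewrite (_ : (fun k => _) = t)//; apply/funext => k.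
  have nw : normc ((w k)%:C)^-1 = (w k)^-1.
    rewrite ComplexField.Normc.normcV /= expr0n addr0 sqrtr_sqr.
    by rewrite gtr0_norm.
  have nx : normc x^*%R = normc x by case: (x) => ? ?; rewrite conjCE /= sqrrN.
  by rewrite !ComplexField.Normc.normcM nw !normcX nx -exprMn.
have [rho [rho0 rho1 qrho]] : exists rho : R, [/\ 0 < rho, rho < 1 & normc x * normc z < rho].
  by exists ((1 + normc x * normc z) / 2); split; lra.
apply: (@ratio_test _ t rho) => // [k|].
  by rewrite divr_ge0 ?exprn_ge0// ltW.
have : (fun k => normc x * normc z * (w k / w k.+1)) @ \oo --> normc x * normc z.
  rewrite -[X in _ --> X]mulr1; exact: cvgMl_tmp.
move/cvgr_lt => /(_ _ qrho); apply: filterS => k H.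
rewrite /t exprS.
have -> : normc x * normc z * (normc x * normc z) ^+ k / w k.+1 =
   (normc x * normc z * (w k / w k.+1)) * ((normc x * normc z) ^+ k / w k).
  by field; rewrite !gt_eqF.
by rewrite ler_wpM2r ?divr_ge0 ?exprn_ge0 ?(ltW H)// ltW.
Qed.

End WeightedSpace.

(** * Linear combinations of kernels *)

Section KernelSpan.
Variables (R : realType) (w : nat -> R).
Hypothesis w_gt0 : forall k, 0 < w k.
Hypothesis w_lim : (fun k => w k / w k.+1) @ \oo --> (1 : R).
Local Notation C := (Cplx R).
Local Notation normc := (@ComplexField.Normc.normc R).
Implicit Types (z x : C) (a b : nat -> C) (f g : C -> C).

Lemma conjRC (x : R) : ((x%:C : C)^*)%R = x%:C.
Proof. by rewrite conjCE oppr0. Qed.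

Lemma energyE a k : (energy w a k)%:C = (a k * (a k)^*%R * (w k)%:C : C).
Proof. by rewrite -normCK normCE -rmorphXn -rmorphM. Qed.

Lemma H2norm_sq f : H2 w f -> H2norm w f ^+ 2 = limn (series (energy w (coefs f))).
Proof.
move=> /H2_coefs[af cf]; rewrite (H2normE w af) sqr_sqrtr//.
apply: limr_ge => //; near=> N; rewrite seriesEnat/=.
by apply: sumr_ge0 => k _; exact: energy_ge0.
Unshelve. all: by end_near. Qed.

Section Points.
Variables (n : nat) (Z : 'I_n -> C).
Hypothesis Z_disk : forall i, `|Z i| < 1.
Implicit Type c : 'I_n -> C.

Definition kernel_comb c : C -> C := fun z => \sum_j c j * repr_kernel w (Z j) z.

Definition kernel_comb_coefs c : nat -> C :=
  fun k => \sum_j c j * ((Z j)^*%R ^+ k / (w k)%:C).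

Lemma kernel_comb_series c : power_series (kernel_comb_coefs c) (kernel_comb c).
Proof.
apply: power_series_sum => j; apply: power_seriesZ.
exact: kernel_power_series.
Qed.

(** The reproducing property: the weights cancel in the pairing with a kernel,
    and what is left is the power series of f at the points.  Neither
    square-summability nor absolute convergence is involved. *)
Lemma pairing_kernel_comb a f c : power_series a f ->
  series (fun k => a k * (kernel_comb_coefs c k)^*%R * (w k)%:C) @ \oo -->
  \sum_j (c j)^*%R * f (Z j).
Proof.
move=> af.
rewrite [X in X @ \oo](_ : _ =
    fun N => \sum_j (c j)^*%R * series (fun k => a k * Z j ^+ k) N).
  apply: cvg_big => [|j _]; first exact: add_continuous.
  by apply: cvgMl_tmp; exact: af.
apply/funext => N; rewrite seriesEnat/=.
under [RHS]eq_bigr do rewrite seriesEnat/= mulr_sumr.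
rewrite exchange_big/=; apply: eq_bigr => k _.
rewrite rmorph_sum/= mulr_sumr mulr_suml; apply: eq_bigr => j _.
have wk : (w k)%:C != 0 :> C by rewrite eq_complex/= gt_eqF.
by rewrite !rmorphM fmorphV rmorphXn/= conjCK conjRC; field.
Qed.

(** The pairing of the combination with itself has real terms; its sum is
    therefore both real and equal to the squared norm. *)
Lemma energy_kernel_comb c :
  (series (energy w (kernel_comb_coefs c)) @ \oo -->
    complex.Re (\sum_j (c j)^*%R * kernel_comb c (Z j) : C)) /\
  (\sum_j (c j)^*%R * kernel_comb c (Z j) : C) =
    (limn (series (energy w (kernel_comb_coefs c))))%:C.
Proof.
have := pairing_kernel_comb (c := c) (kernel_comb_series (c := c)); set l := \sum_j _ => cl.
have E : (fun k => kernel_comb_coefs c k * (kernel_comb_coefs c k)^*%R * (w k)%:C) =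
   (fun k => (energy w (kernel_comb_coefs c) k)%:C) by apply/funext => k; rewrite energyE.
rewrite E in cl; have cr : series (energy w (kernel_comb_coefs c)) @ \oo --> complex.Re l.
  rewrite [X in X @ \oo](_ : _ = fun N =>
      complex.Re (series (fun k => (energy w (kernel_comb_coefs c) k)%:C : C) N)).
    exact: cvg_Re.
  by apply/funext => N; rewrite series_Re.
split=> //.
apply: (cvg_unique (@norm_hausdorff _ C) cl).
apply: cvg_ReIm => /=.
  by under eq_fun do rewrite series_Re; exact: (cvgP _ cr).
under eq_fun do rewrite series_Im.
rewrite [X in X @ \oo](_ : _ = fun=> 0); first exact: cvg_cst.
by apply/funext => N; rewrite seriesEnat/= big1.
Qed.

Lemma H2_kernel_comb c : H2 w (kernel_comb c).
Proof.
exists (kernel_comb_coefs c); first exact: kernel_comb_series.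
have [cl _] := energy_kernel_comb c; exact: cvgP cl.
Qed.

(** This is |a_k - b_k|^2 w_k >= 0, expanded. *)
Lemma Re_energy_subr_ge a b k :
  2 * complex.Re (a k * (b k)^*%R * (w k)%:C) - energy w b k <= energy w a k.
Proof.
have w0 := w_gt0 k; rewrite /energy !sqr_normcE.
case: (a k) (b k) => x y [x' y']; rewrite conjCE /=.
have : 0 <= ((x - x') ^+ 2 + (y - y') ^+ 2) * w k.
  by rewrite mulr_ge0 ?addr_ge0 ?sqr_ge0// ltW.
by nra.
Qed.

(** The inequality ||f - u||^2 >= 0, where u is the combination of kernels and
    <f, u> is computed by the reproducing property.  A single point x and the
    coefficient t f(x) turn it into a bound on the evaluation at x; the points
    of Z and the coefficients v K^-1 turn it into a lower bound on the distance. *)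
Lemma H2norm_ge_kernel_comb f c : H2 w f ->
  2 * complex.Re (\sum_j (c j)^*%R * f (Z j) : C)
    - complex.Re (\sum_j (c j)^*%R * kernel_comb c (Z j) : C) <= H2norm w f ^+ 2.
Proof.
move=> Hf; rewrite H2norm_sq//; have [af cf] := H2_coefs Hf.
have [ce _] := energy_kernel_comb c.
have cp := cvg_Re (pairing_kernel_comb (c := c) af).
have c2 : (fun N => 2 * complex.Re (series (fun k => coefs f k * (kernel_comb_coefs c k)^*%R * (w k)%:C) N)
   - series (energy w (kernel_comb_coefs c)) N) @ \oo -->
   2 * complex.Re (\sum_j (c j)^*%R * f (Z j) : C)
    - complex.Re (\sum_j (c j)^*%R * kernel_comb c (Z j) : C).
  by apply: cvgB => //; apply: cvgMl_tmp.
apply: ler_cvg_to c2 cf _; near=> N.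
rewrite series_Re !seriesEnat/= mulr_sumr -sumrB; apply: ler_sum => k _.
exact: Re_energy_subr_ge.
Unshelve. all: by end_near. Qed.

End Points.
End KernelSpan.

(** * The distance to the cyclic subspace *)

Section Distance.
Variables (R : realType) (w : nat -> R).
Hypothesis w_gt0 : forall k, 0 < w k.
Hypothesis w_lim : (fun k => w k / w k.+1) @ \oo --> (1 : R).
Local Notation C := (Cplx R).
Local Notation normc := (@ComplexField.Normc.normc R).
Implicit Types (z x : C) (a b : nat -> C) (f g : C -> C).

(** Apply the inequality above to the kernel at x with coefficient t f(x): it
    gives (2 t - t^2 k_x(x)) |f(x)|^2 <= ||f||^2, and t is chosen small enough
    to have t k_x(x) <= 1, which leaves t |f(x)|^2 on the left. *)
Lemma H2_eval_bounded x : `|x| < 1 ->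
  exists2 d : R, 0 < d & forall f, H2 w f -> d * normc (f x) ^+ 2 <= H2norm w f ^+ 2.
Proof.
move=> x1; pose K := complex.Re (repr_kernel w x x).
pose t := (1 + `|K|)^-1.
have D0 : 0 < 1 + `|K| by rewrite ltr_pwDl.
have t0 : 0 < t by rewrite invr_gt0.
have tK : t * K <= 1.
  by rewrite mulrC ler_pdivrMr// mul1r (le_trans (ler_norm _))// lerDr.
exists t => // f Hf.
have := H2norm_ge_kernel_comb w_gt0 w_lim (Z := fun=> x) (n := 1)
  (fun _ => x1) (fun=> t%:C * f x) Hf.
rewrite /kernel_comb !big_ord1.
have -> : ((t%:C * f x)^*%R * f x : C) = (t * normc (f x) ^+ 2)%:C.
  by rewrite rmorphM/= conjRC -mulrA -normCKC normCE -rmorphXn -rmorphM.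
have -> : ((t%:C * f x)^*%R * (t%:C * f x * repr_kernel w x x) : C) =
    (t ^+ 2 * normc (f x) ^+ 2)%:C * repr_kernel w x x.
  have E : `|f x| ^+ 2 = (normc (f x) ^+ 2)%:C :> C by rewrite normCE -rmorphXn.
  have -> : (t ^+ 2 * normc (f x) ^+ 2)%:C = (t%:C ^+ 2 * `|f x| ^+ 2 : C).
    by rewrite E -rmorphXn -rmorphM.
  by rewrite normCKC rmorphM/= conjRC; ring.
have -> : complex.Re ((t ^+ 2 * normc (f x) ^+ 2)%:C * repr_kernel w x x : C) =
    t ^+ 2 * normc (f x) ^+ 2 * K.
  by rewrite /K; case: (repr_kernel w x x) => p q /=; rewrite mul0r subr0.
rewrite Re_real; apply: le_trans.
have s0 : 0 <= t * normc (f x) ^+ 2 by rewrite mulr_ge0 ?sqr_ge0// ltW.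
by nra.
Qed.

Lemma H2norm0_eq0 f : H2 w f -> H2norm w f = 0 -> forall z, `|z| < 1 -> f z = 0.
Proof.
move=> Hf f0 z z1; have [d d0 /(_ f Hf)] := H2_eval_bounded z1.
rewrite f0 expr0n/= pmulr_rle0// => H.
apply: ComplexField.Normc.eq0_normc; apply/eqP; rewrite -sqrf_eq0.
by rewrite eq_le H sqr_ge0.
Qed.

Lemma H2norm_eq0 f : (forall z, `|z| < 1 -> f z = 0) -> H2norm w f = 0.
Proof.
move=> f0; have ps : power_series (fun=> 0) f.
  by apply: (power_series_ext _ (@power_series0 R)) => z z1; rewrite f0.
rewrite (H2normE w ps) (_ : series _ = fun=> 0) ?lim_cst ?sqrtr0//.
apply/funext => N; rewrite seriesEnat/= big1// => k _.
by rewrite /energy /= expr0n addr0 sqrtr0 expr0n mul0r.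
Qed.

(** Polynomial multiples of g vanish at x, and the evaluation at x is bounded,
    so it kills the closure too. *)
Lemma cyclic_subspace_vanish g x h : `|x| < 1 -> H2 w g -> g x = 0 ->
  cyclic_subspace w g h -> h x = 0.
Proof.
move=> x1 Hg gx [Hh happ]; have [d d0 ev] := H2_eval_bounded x1.
apply: ComplexField.Normc.eq0_normc; apply/eqP; rewrite -sqrf_eq0.
rewrite eq_le sqr_ge0 andbT leNgt; apply/negP => A0.
set A := normc _ ^+ 2 in A0.
have dA : 0 < d * A by rewrite mulr_gt0.
have [p] := happ (Num.sqrt (d * A)) ltac:(by rewrite sqrtr_gt0).
have Hp : H2 w (fun z => h z - p.[z] * g z).
  rewrite (_ : (fun z => _) = fun z => h z + (-1) * (p.[z] * g z)).
    exact: H2D Hh (H2Z _ (H2_horner w_gt0 w_lim p Hg)).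
  by apply/funext => z; rewrite mulN1r.
have := ev _ Hp; rewrite gx mulr0 subr0 -/A => le1 lt1.
have : H2norm w (fun z => h z - p.[z] * g z) ^+ 2 < d * A.
  rewrite -[ltRHS]sqr_sqrtr; last exact: ltW.
  by rewrite ltr_sqr ?nnegrE ?sqrtr_ge0.
by rewrite ltNge le1.
Qed.

Lemma H2norm_ge0 f : 0 <= H2norm w f.
Proof. exact: sqrtr_ge0. Qed.

Lemma ler_of_sqr (s t : R) : 0 <= t -> s ^+ 2 <= t ^+ 2 -> s <= t.
Proof. by move=> t0 st; rewrite leNgt; apply/negP => ts; nra. Qed.

Lemma coefs_repr_kernel x : `|x| < 1 ->
  coefs (repr_kernel w x) = fun k => (x^* ^+ k / (w k)%:C)%R.
Proof. by move=> x1; apply: coefsE; exact: kernel_power_series. Qed.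

Lemma gramE n (Z : 'I_n -> C) (Z_disk : forall i, `|Z i| < 1) i j :
  gram w Z i j = repr_kernel w (Z i) (Z j).
Proof.
rewrite mxE /inner; congr (lim (_ @ \oo)); congr series; apply/funext => k.
transitivity ((Z i)^* ^+ k / (w k)%:C * ((Z j)^* ^+ k / (w k)%:C)^* * (w k)%:C)%R.
  by congr (_ * _^*%R * _); rewrite coefs_repr_kernel.
have wk : (w k)%:C != 0 :> C by rewrite eq_complex/= gt_eqF.
by rewrite rmorphM fmorphV rmorphXn/= conjCK conjRC; field.
Qed.

Section Points.
Variables (n : nat) (Z : 'I_n -> C).
Hypothesis Z_disk : forall i, `|Z i| < 1.
Hypothesis Z_inj : injective Z.

Lemma kernel_comb_gram (x : 'rV[C]_n) j :
  kernel_comb w Z (x 0) (Z j) = (x *m gram w Z) 0 j.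
Proof. by rewrite mxE; apply: eq_bigr => i _; rewrite gramE. Qed.

(** All Taylor coefficients vanish, so sum_i c_i p(conj z_i) = 0 for every
    polynomial p; take for p the one that vanishes at every conj z_i except
    conj z_j. *)
Lemma kernel_comb_free (c : 'I_n -> C) :
  (forall z, `|z| < 1 -> kernel_comb w Z c z = 0) -> c =1 fun=> 0.
Proof.
move=> c0 j.
have ps : power_series (kernel_comb_coefs w Z c) (fun=> 0).
  by apply: power_series_ext (kernel_comb_series w_gt0 w_lim Z_disk (c := c)).
have pow0 k : \sum_i c i * (Z i)^*%R ^+ k = 0.
  have wk : (w k)%:C != 0 :> C by rewrite eq_complex/= gt_eqF.
  apply: (mulIf (invr_neq0 wk)); rewrite mul0r mulr_suml.
  rewrite -[RHS](power_series_eq0 ps k); apply: eq_bigr => i _.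
  by rewrite mulrA.
have sum0 (p : {poly C}) : \sum_i c i * p.[(Z i)^*%R] = 0.
  under eq_bigr do rewrite horner_coef mulr_sumr.
  rewrite exchange_big big1//= => k _.
  transitivity (p`_k * \sum_i c i * (Z i)^*%R ^+ k); last by rewrite pow0 mulr0.
  by rewrite mulr_sumr; apply: eq_bigr => i _; rewrite mulrCA.
pose p := \prod_(i | i != j) ('X - ((Z i)^*%R)%:P).
have pE i : i != j -> p.[(Z i)^*%R] = 0.
  by move=> ij; rewrite horner_prod (bigD1 i)//= hornerXsubC subrr mul0r.
have := sum0 p; rewrite (bigD1 j)//= big1 ?addr0 => [|i /pE ->]; last by rewrite mulr0.
move/eqP; rewrite mulf_eq0 => /orP[/eqP//|].
rewrite horner_prod => /prodf_eq0[i ij].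
rewrite hornerXsubC subr_eq0 => /eqP/(inv_inj conjCK)/Z_inj ji.
by rewrite ji eqxx in ij.
Qed.

(** A row x with x K = 0 gives a combination of kernels whose squared norm,
    sum_j conj(x_j) u(z_j), is 0. *)
Lemma gram_unitmx : gram w Z \in unitmx.
Proof.
rewrite -row_free_unit -kermx_eq0; apply/rowV0P => x /sub_kermxP xK.
have x0 j : kernel_comb w Z (x 0) (Z j) = 0 by rewrite kernel_comb_gram xK mxE.
have Hx := H2_kernel_comb w_gt0 w_lim Z_disk (x 0).
have n0 : H2norm w (kernel_comb w Z (x 0)) = 0.
  apply/eqP; rewrite -sqrf_eq0 H2norm_sq//.
  rewrite (coefsE (kernel_comb_series w_gt0 w_lim Z_disk (c := x 0))).
  have [cl _] := energy_kernel_comb w_gt0 w_lim Z_disk (x 0).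
  by rewrite (cvg_lim _ cl)// big1// => j _; rewrite x0 mulr0.
have := kernel_comb_free (H2norm0_eq0 Hx n0) => xE.
by apply/rowP => j; rewrite xE mxE.
Qed.

(** The coefficients of the combination of kernels that takes the value 1 at all
    the points of Z. *)
Let c : 'rV[C]_n := const_mx 1 *m invmx (gram w Z).

(** Schur complement of K in the bordered matrix: the block factorization has
    the scalar 1 - v K^-1 k(z) in its upper left corner. *)
Lemma f_ZE z : f_Z w Z z = \det (gram w Z) * (1 - kernel_comb w Z (c 0) z).
Proof.
rewrite /f_Z; set k := \col_i _; set K := gram w Z; set v := const_mx 1.
have -> : block_mx 1%:M v k K =
    block_mx 1%:M (v *m invmx K) 0 1%:M *m block_mx (1%:M - v *m invmx K *m k) 0 k K.
  rewrite mulmx_block !mul1mx !mul0mx !add0r mulmxKV ?gram_unitmx// subrK.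
  by [].
rewrite det_mulmx det_ublock det_lblock !det1 !mul1r mulrC; congr (_ * _).
rewrite det_mx11 !mxE eqxx; congr (1 - _); apply: eq_bigr => i _.
by rewrite !mxE.
Qed.

Lemma kernel_comb_interpolates j : kernel_comb w Z (c 0) (Z j) = 1.
Proof. by rewrite kernel_comb_gram mulmxKV ?gram_unitmx// mxE. Qed.

(** The squared norm comes out as the sum of the conjugates of the c_j; being
    real, it is also the sum of the c_j. *)
Lemma H2norm_kernel_comb_sq :
  (H2norm w (kernel_comb w Z (c 0)) ^+ 2)%:C = \sum_j c 0 j :> C /\
  \sum_j (c 0 j)^*%R = \sum_j c 0 j :> C.
Proof.
have Hu := H2_kernel_comb w_gt0 w_lim Z_disk (c 0).
have [_] := energy_kernel_comb w_gt0 w_lim Z_disk (c 0).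
rewrite H2norm_sq// (coefsE (kernel_comb_series w_gt0 w_lim Z_disk (c := c 0))).
under eq_bigr do rewrite kernel_comb_interpolates mulr1.
move=> E; have E' : \sum_j (c 0 j)^*%R = \sum_j c 0 j.
  by rewrite -[RHS]conjCK rmorph_sum/= E conjRC.
by rewrite -E E'.
Qed.

(** The minimum of ||1 - h|| over h in [g_Z] is reached at h = 1 - u. *)
Lemma distH_shapiro_shields :
  distH w (fun=> 1) (cyclic_subspace w (shapiro_shields w Z)) =
  H2norm w (kernel_comb w Z (c 0)).
Proof.
set u := kernel_comb w Z (c 0); set g := shapiro_shields w Z.
have Hu : H2 w u := H2_kernel_comb w_gt0 w_lim Z_disk (c 0).
have detK : \det (gram w Z) != 0 by have := gram_unitmx; rewrite unitmxE unitfE.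
have Hr : H2 w (fun z => 1 - u z).
  rewrite (_ : (fun z => _) = fun z => 1 + (-1) * u z).
    exact: H2D (H2_cst w 1) (H2Z _ Hu).
  by apply/funext => z; rewrite mulN1r.
have HfZ : H2 w (f_Z w Z).
  rewrite (_ : f_Z w Z = fun z => \det (gram w Z) * (1 - u z)); first exact: H2Z.
  by apply/funext => z; rewrite f_ZE.
have Hg : H2 w g.
  rewrite (_ : g = fun z => (H2norm w (f_Z w Z))%:C^-1 * f_Z w Z z); first exact: H2Z.
  by apply/funext => z; rewrite mulrC.
have gZ j : g (Z j) = 0.
  by rewrite /g /shapiro_shields f_ZE kernel_comb_interpolates subrr mulr0 mul0r.
have lower h : cyclic_subspace w g h -> H2norm w u <= H2norm w (fun z => 1 - h z).
  move=> hg; have Hh := hg.1.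
  have H1h : H2 w (fun z => 1 - h z).
    rewrite (_ : (fun z => _) = fun z => 1 + (-1) * h z).
      exact: H2D (H2_cst w 1) (H2Z _ Hh).
    by apply/funext => z; rewrite mulN1r.
  apply: (ler_of_sqr (H2norm_ge0 _)).
  apply: le_trans (H2norm_ge_kernel_comb w_gt0 w_lim Z_disk (c 0) H1h).
  have -> : \sum_j (c 0 j)^*%R * (1 - h (Z j)) = \sum_j (c 0 j)^*%R.
    apply: eq_bigr => j _.
    by rewrite (cyclic_subspace_vanish (Z_disk j) Hg (gZ j) hg) subr0 mulr1.
  have -> : \sum_j (c 0 j)^*%R * kernel_comb w Z (c 0) (Z j) = \sum_j (c 0 j)^*%R.
    by apply: eq_bigr => j _; rewrite kernel_comb_interpolates mulr1.
  have [E1 E2] := H2norm_kernel_comb_sq; rewrite E2 -E1 Re_real.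
  by rewrite mulr_natl mulr2n addrK.
have attained : cyclic_subspace w g (fun z => 1 - u z).
  split=> // e e0; exists ((H2norm w (f_Z w Z))%:C / \det (gram w Z))%:P.
  rewrite H2norm_eq0// => z z1; rewrite hornerC /g /shapiro_shields f_ZE -/u.
  (* If f_Z had norm 0, the normalization would divide by 0; but then 1 - u,
     proportional to f_Z, is 0 on the disk and the approximation is trivial. *)
  have [N0|N0] := eqVneq (H2norm w (f_Z w Z)) 0.
    rewrite N0 mul0r mul0r subr0; have := H2norm0_eq0 HfZ N0 z1.
    by rewrite f_ZE => /eqP; rewrite mulf_eq0 (negPf detK)/= => /eqP.
  have NC : (H2norm w (f_Z w Z))%:C != 0 :> C by rewrite eq_complex/= (negPf N0).
  by field; rewrite NC detK.
apply/eqP; rewrite eq_le; apply/andP; split; last first.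
  apply: lb_le_inf; first by exists (H2norm w (fun z => 1 - (1 - u z))), (fun z => 1 - u z).
  by move=> _ [h hg <-]; exact: lower.
apply: ge_inf; first by exists (H2norm w u) => _ [h hg <-]; exact: lower.
exists (fun z => 1 - u z); first exact: attained.
by congr (H2norm w _); apply/funext => z; rewrite subKr.
Qed.

End Points.
End Distance.

Theorem theorem3p5 (R : realType) (w : nat -> R)
    (w_gt0 : forall k, 0 < w k) (w0 : w 0%N = 1)
    (w_lim : (fun k => w k / w k.+1) @ \oo --> (1 : R))
    (n : nat) (Z : 'I_n -> Cplx R) (Z_inj : injective Z)
    (Z_disk : forall i, `|Z i| < 1) (Z_neq0 : forall i, Z i != 0) :
  let v : 'rV[Cplx R]_n := const_mx 1 in
  (distH w (fun=> 1) (cyclic_subspace w (shapiro_shields w Z)) ^+ 2)%:C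
    = (v *m invmx (gram w Z) *m v ^t*) 0 0.
Proof.
move=> v; rewrite distH_shapiro_shields//.
have [-> _] := H2norm_kernel_comb_sq w_gt0 w_lim Z_disk Z_inj.
by rewrite [RHS]mxE; apply: eq_bigr => j _; rewrite !mxE conjC1 mulr1.
Qed.
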